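(* The cycle index of the $3$-group $S_9^{(3)}$ of the symmetric group $S_9$, i.e. of the action of $S_9$ on the $84$ three-element subsets of $\{1,\dots,9\}$, in the variables $a_1,a_2,\dots$, is \begin{align*} Z(S_9^{(3)}) = \frac{1}{9!} \big(& a_{1}^{84} + 36 a_{1}^{42} a_{2}^{21} + 168 a_{1}^{21} a_{3}^{21} + 378 a_{1}^{20} a_{2}^{32} + 1260 a_{1}^{10} a_{2}^{37} \\ & + 756 a_{1}^{10} a_{2}^{5} a_{4}^{16} + 2520 a_{1}^{9} a_{2}^{6} a_{3}^{11} a_{6}^{5} + 7560 a_{1}^{5} a_{2}^{8} a_{3}^{5} a_{6}^{8} + 945 a_{1}^{4} a_{2}^{40} \\ & + 7560 a_{1}^{4} a_{2}^{8} a_{4}^{16} + 3024 a_{1}^{4} a_{5}^{16} + 5600 a_{1}^{3} a_{3}^{27} + 10080 a_{1}^{3} a_{3}^{13} a_{6}^{7} \\ & + 18144 a_{1}^{2} a_{2} a_{5}^{8} a_{10}^{4} + 11340 a_{1}^{2} a_{2}^{9} a_{4}^{16} + 15120 a_{1} a_{2}^{2} a_{3}^{3} a_{4}^{4} a_{6} a_{12}^{4} \\ & + 15120 a_{1} a_{2}^{2} a_{3} a_{4}^{4} a_{6}^{2} a_{12}^{4} + 24192 a_{1} a_{3} a_{5}^{4} a_{15}^{4} + 2520 a_{1} a_{2}^{10} a_{3}^{3} a_{6}^{9} \\ & + 30240 a_{1} a_{2} a_{3}^{3} a_{6}^{12} + 30240 a_{1} a_{2} a_{3} a_{6}^{13}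 + 9072 a_{2}^{2} a_{5}^{4} a_{10}^{6} \\ & + 18144 a_{4} a_{5}^{2} a_{10} a_{20}^{3} + 25920 a_{7}^{6} a_{14}^{3} + 11340 a_{2}^{2} a_{4}^{20} + 40320 a_{3} a_{9}^{9} \\ & + 45360 a_{4} a_{8}^{10} + 25920 a_{7}^{12}\big). \end{align*}
   Context: For a permutation group $A$ on a finite set, and $\alpha\in A$, let $j_k(\alpha)$ be the number of cycles of length $k$ in the disjoint cycle decomposition of $\alpha$ (fixed points counted as cycles of length $1$). The cycle index of $A$ is the polynomial $Z(A)=\frac{1}{|A|}\sum_{\alpha\in A}\prod_{k} a_k^{j_k(\alpha)}$ in the variables $a_1,a_2,\dots$ with rational coefficients. For $1\le r\le p$, $S_p^{(r)}$ (the $r$-group of $S_p$) is the permutation group on the set of $r$-element subsets of $\{1,\dots,p\}$ formed by the permutations $\alpha'$ induced by $\alpha\in S_p$ via $\alpha'\{i_1,\dots,i_r\}=\{\alpha i_1,\dots,\alpha i_r\}$. *)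

(* Defs.v *)
From mathcomp Require Import all_boot all_order all_algebra all_fingroup.
From mathcomp Require Import xfinmap monalg.

Set Implicit Arguments.
Unset Strict Implicit.
Unset Printing Implicit Defensive.

Import GRing.Theory.
Local Open Scope ring_scope.

(* Polynomials over rat in countably many commuting variables: monomials are
   finitely supported exponent functions nat -> nat. *)
Notation cipoly := {malg rat[{cmonom nat}]}.

(* The variable a_k; the index 0 is never used. *)
Definition civar (k : nat) : cipoly := << ucm k >>.
Notation "''a_' k" := (civar k) (at level 8, k at level 2, format "''a_' k").

(* porbits s contains the fixed points of s as singletons. *)
Definition ncycles (T : finType) (k : nat) (s : {perm T}) : nat :=
  #|[set C in porbits s | #|C| == k]|.

(* No cycle is longer than #|T|, so the product contains every nontrivial
   factor. *)
Definition cycle_index (T : finType) (A : {group {perm T}}) : cipoly :=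
  (#|A|%:R : rat)^-1 *:
    \sum_(s in A) \prod_(1 <= k < #|T|.+1) 'a_k ^+ ncycles k s.

Definition rsubset (p r : nat) : finType := {A : {set 'I_p} | #|A| == r}.

Section RGroup.

Variables p r : nat.
Implicit Types (s t : 'S_p) (A : rsubset p r).

Lemma card_im_rsubset s A : #|s @: val A| == r.
Proof. by rewrite card_imset ?(valP A) //; exact: perm_inj. Qed.

Definition induced_fun s A : rsubset p r :=
  exist _ (s @: val A) (card_im_rsubset s A).

Lemma induced_fun_inj s : injective (induced_fun s).
Proof.
move=> A B /(congr1 val) /= eqAB; apply: val_inj.
exact: (imset_inj (@perm_inj _ s)) eqAB.
Qed.

Definition induced s : {perm rsubset p r} := perm (@induced_fun_inj s).

Lemma inducedM : {in [set: 'S_p] &, {morph induced : s t / (s * t)%g}}.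
Proof.
move=> s t _ _; apply/permP=> A; rewrite permM !permE; apply: val_inj => /=.
by rewrite -imset_comp; apply: eq_imset => i /=; rewrite permM.
Qed.

Canonical induced_morphism := Morphism inducedM.

(* The r-group of S_p: the image of S_p under s |-> induced s. *)
Definition rgroup : {group {perm rsubset p r}} :=
  (induced @* [set: 'S_p])%G.

End RGroup.

(* Main.v *)
Require Import Defs.
From Stdlib Require Import BinNatDef.
From mathcomp Require Import all_boot all_order all_algebra all_fingroup.
From mathcomp Require Import monalg.

Set Implicit Arguments.
Unset Strict Implicit.
Unset Printing Implicit Defensive.

Import GRing.Theory.

(** Multiplying a permutation of [0, n) by a transposition involving [n] either
    adds the fixed point [n] or inserts [n] into one of the cycles, which can be
    done in [k] ways for a cycle of length [k]. This gives a recursion for the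
    number of permutations of each cycle type. If the characteristic sequence of
    a subset is read along the cycles of [s], then [s] acts on it by rotating
    each block, so the cycle lengths of the induced permutation are computable
    from the cycle type of [s] alone. Since S_n acts faithfully on the
    r-subsets for 0 < r < n, the cycle index is a sum over cycle types, which
    is evaluated for n = 9 and r = 3. *)

(** * Cycle decompositions as sequences of sequences *)

Section CycleType.

Context {T : finType}.
Implicit Types (s : {perm T}) (cs : seq (seq T)).

(* The condition [map s c = rot 1 c] says that [s] sends each entry of [c] to
   the cyclically next one. *)
Definition is_cycle_decomposition s cs :=
  perm_eq (flatten cs) (enum T) /\ {in cs, forall c, map s c = rot 1 c}.

Definition has_cycle_type s (l : seq nat) :=
  exists2 cs, is_cycle_decomposition s cs & perm_eq (shape cs) l.

Lemma perm_cycle_decomposition s cs cs' :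
  perm_eq cs cs' -> is_cycle_decomposition s cs -> is_cycle_decomposition s cs'.
Proof.
move=> eq_cs [cs_enum cs_rot]; split; last first.
  by move=> c; rewrite -(perm_mem eq_cs); exact: cs_rot.
by rewrite -(permPl (perm_flatten eq_cs)).
Qed.

(** Any reordering of the lengths is realised by reordering the cycles themselves. *)
Lemma has_cycle_typeP s l :
  has_cycle_type s l -> exists2 cs, is_cycle_decomposition s cs & shape cs = l.
Proof.
case=> cs dec_cs; rewrite perm_sym => /(perm_iotaP 0%N)[js].
rewrite size_map => eq_js def_l; exists (map (nth [::] cs) js).
  by apply: perm_cycle_decomposition dec_cs; rewrite perm_sym; apply/(perm_iotaP [::]); exists js.
rewrite def_l /shape -map_comp; apply/eq_in_map => j.
by rewrite (perm_mem eq_js) mem_iota => /andP[_ ltj]; rewrite /= (nth_map [::]).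
Qed.

End CycleType.

(** * Inserting a new point into a permutation *)

Section Insertion.

Variable n : nat.
Implicit Types (s : 'S_n) (i : 'I_n.+1) (x : 'I_n).

(* Permutations compose from left to right, so the entry that [s] sends to [i]
   is now sent to [ord_max], and [ord_max] to [i]. *)
Definition insert_max i s : 'S_n.+1 :=
  (lift_perm ord_max ord_max s * tperm ord_max i)%g.

Lemma insert_max_max i s : insert_max i s ord_max = i.
Proof. by rewrite permM lift_perm_id tpermL. Qed.

(** [i] is recovered as the image of [ord_max], after which [s] follows by cancellation; both sides
    have (n+1)! elements. *)
Lemma insert_max_bij : bijective (fun p : 'I_n.+1 * 'S_n => insert_max p.1 p.2).
Proof.
apply: inj_card_bij => [[i s] [j t] /= eq_st|].
  have eq_ij : i = j by rewrite -(insert_max_max i s) eq_st insert_max_max.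
  subst j; congr (_, _); apply/permP=> x; apply: (@lift_inj _ ord_max).
  rewrite -!(lift_perm_lift ord_max); congr (fun_of_perm _ _).
  exact: mulIg eq_st.
by rewrite card_prod !card_Sn card_ord factS.
Qed.

Let up := map (lift (@ord_max n)).

Lemma perm_lift_enum : perm_eq (ord_max :: up (enum 'I_n)) (enum 'I_n.+1).
Proof.
apply: uniq_perm; rewrite ?enum_uniq //=.
  rewrite map_inj_uniq ?enum_uniq ?andbT //; last exact: lift_inj.
  by apply/mapP => -[x _ /eqP]; rewrite eq_liftF.
move=> i; rewrite mem_enum inE; case: (unliftP ord_max i) => [x|] ->; rewrite ?eqxx //.
by rewrite map_f ?orbT ?mem_enum.
Qed.

Lemma perm_flatten_up cs :
  perm_eq (flatten cs) (enum 'I_n) ->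
  perm_eq (ord_max :: flatten (map up cs)) (enum 'I_n.+1).
Proof.
move=> cs_enum; rewrite -map_flatten -(permPr perm_lift_enum) perm_cons.
exact: perm_map.
Qed.

Lemma map_insert_max i s (c : seq 'I_n) :
  map (insert_max i s) (up c) = map (tperm ord_max i) (up (map s c)).
Proof.
by rewrite /up -!map_comp; apply: eq_map => x /=; rewrite permM lift_perm_lift.
Qed.

Lemma map_tperm_up i (c : seq 'I_n) :
  i \notin up c -> map (tperm ord_max i) (up c) = up c.
Proof.
move=> c_i; apply: map_id_in => _ /mapP[x c_x ->].
by rewrite tpermD ?neq_lift //; apply: contraNneq c_i => ->; rewrite map_f.
Qed.

Lemma insert_max_fixed s l : has_cycle_type s l ->
  has_cycle_type (insert_max ord_max s) (1%N :: l).
Proof.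
case=> cs [cs_enum cs_rot] cs_l; exists ([:: ord_max] :: map up cs); last first.
  rewrite /= perm_cons /shape -map_comp (eq_map (g := size)) // => c.
  by rewrite /= size_map.
split=> [|c]; first exact: perm_flatten_up.
rewrite inE => /predU1P[->|/mapP[d cs_d ->]].
  by rewrite /= insert_max_max.
rewrite map_insert_max map_tperm_up ?cs_rot ?/up ?map_rot //.
by rewrite mem_rot; apply/mapP => -[x _ /eqP]; rewrite eq_liftF.
Qed.

(** Rotate [c] so that it starts at [x] and put [ord_max] in front: the last entry, formerly sent to
    [x], is now sent to [ord_max], and [ord_max] to [x]. The other cycles avoid [x], so the
    transposition leaves them alone. *)
Lemma insert_max_lengthen s cs c x :
    is_cycle_decomposition s cs -> c \in cs -> x \in c ->
  has_cycle_type (insert_max (lift ord_max x) s)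
    ((size c).+1 :: rem (size c) (shape cs)).
Proof.
move=> dec_cs cs_c c_x.
have: is_cycle_decomposition s (c :: rem c cs).
  exact: perm_cycle_decomposition (perm_to_rem cs_c) dec_cs.
have: perm_eq (rem (size c) (shape cs)) (shape (rem c cs)).
  rewrite -(perm_cons (size c)) perm_sym.
  rewrite -(permPr (perm_to_rem (map_f size cs_c))) perm_sym.
  exact: (perm_map size (perm_to_rem cs_c)).
move: (rem c cs) => ds eq_ds [ds_enum ds_rot].
have uniq_ds : uniq (c ++ flatten ds).
  by rewrite -[_ ++ _]/(flatten (c :: ds)) (perm_uniq ds_enum) enum_uniq.
have [j p def_p] := rot_to c_x.
have eq_pc : perm_eq (x :: p) c by rewrite -def_p perm_rot.
have p_x : x \notin p.
  have: uniq (x :: p).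
    by rewrite -def_p rot_uniq; move: uniq_ds; rewrite cat_uniq => /and3P[].
  by case/andP.
have sp : map s (x :: p) = rcons p x.
  by rewrite -def_p map_rot ds_rot ?mem_head // rot_rot def_p rot1_cons.
exists ((ord_max :: lift ord_max x :: up p) :: map up ds); last first.
  rewrite /= size_map -(perm_size eq_pc) perm_cons perm_sym.
  rewrite (perm_size eq_pc) (permPl eq_ds) /shape -map_comp.
  by rewrite (eq_map (g := size)) // => d; rewrite /= size_map.
split=> [|d].
  apply: (perm_trans _ (perm_flatten_up ds_enum)).
  rewrite /= perm_cons -cat_cons perm_cat2r.
  exact: (perm_map _ eq_pc).
rewrite inE => /predU1P[->|/mapP[e ds_e ->]].
  rewrite rot1_cons map_cons insert_max_max; congr (_ :: _).
  rewrite -[LHS]/(map _ (up (x :: p))) map_insert_max sp /up map_rcons map_rcons.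
  by rewrite map_tperm_up ?tpermR // mem_map //; exact: lift_inj.
rewrite map_insert_max map_tperm_up ds_rot ?inE ?ds_e ?orbT // /up map_rot //.
rewrite mem_rot mem_map; last exact: lift_inj.
move: uniq_ds; rewrite cat_uniq => /and3P[_ /hasPn ds_c _].
apply/negP=> e_x; have /ds_c/negP[//]: x \in flatten ds.
by apply/flattenP; exists e.
Qed.
End Insertion.

(** * Enumerating cycle types with binary multiplicities, for efficient evaluation *)

Lemma nat_of_bin_add (m k : N) : N.add m k = m + k :> nat.
Proof. by case: m k => [|p] [|q] //=; rewrite ?addn0 // nat_of_add_pos. Qed.

Lemma nat_of_bin_mul (m k : N) : N.mul m k = m * k :> nat.
Proof. by case: m k => [|p] [|q] //=; rewrite ?muln0 // nat_of_mul_pos. Qed.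

Section Collect.

Variable K : eqType.

Fixpoint add_term (x : K) (m : N) (t : seq (K * N)) :=
  if t is (y, k) :: t' then
    if x == y then (y, N.add m k) :: t' else (y, k) :: add_term x m t'
  else [:: (x, m)].

Definition collect (t : seq (K * N)) := foldr (fun p => add_term p.1 p.2) [::] t.

Lemma sum_collect (V : nmodType) (G : K -> V) t :
  (\sum_(p <- collect t) G p.1 *+ p.2 = \sum_(p <- t) G p.1 *+ p.2)%R.
Proof.
elim: t => [|[x m] t IHt] //=; rewrite big_cons /= -IHt.
elim: (collect t) => [|[y k] u IHu] /=; first by rewrite big_cons.
case: eqP => [->|_]; rewrite !big_cons /=.
  by rewrite nat_of_bin_add mulrnDr addrA.
by rewrite IHu addrCA.
Qed.

End Collect.

(** Sorting makes each cycle type a canonical key, so that [collect] can merge equal ones. A length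
    occurring several times in [l] gives one entry per cycle, with [k] insertion places each. *)
Definition grow (l : seq nat) : seq (seq nat * N) :=
  (sort geq (1%N :: l), 1%num)
    :: [seq (sort geq (k.+1 :: rem k l), bin_of_nat k) | k <- l].

Fixpoint cycle_types (n : nat) : seq (seq nat * N) :=
  if n is n'.+1 then
    collect [seq (q.1, N.mul q.2 p.2) | p <- cycle_types n', q <- grow p.1]
  else [:: ([::], 1%num)].

Lemma has_cycle_type_sort (T : finType) (s : {perm T}) l :
  has_cycle_type s l -> has_cycle_type s (sort geq l).
Proof.
by case=> cs dec_cs cs_l; exists cs => //; rewrite perm_sym perm_sort perm_sym.
Qed.

Local Open Scope ring_scope.

(** Induction along [insert_max]: for fixed [s], the sum over the inserted image [i] depends only on
    the cycle type of [s], so the induction hypothesis applies to it. *)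
Lemma sum_cycle_types (V : nmodType) n (F : 'S_n -> V) (G : seq nat -> V) :
    (forall s l, has_cycle_type s l -> F s = G l) ->
  \sum_s F s = \sum_(p <- cycle_types n) G p.1 *+ p.2.
Proof.
elim: n F G => [|n IHn] F G FG.
  rewrite big_seq1 (big_pred1 1%g) => [|s]; last first.
    by apply/esym/eqP/permP=> -[].
  apply: FG; exists [::] => //; split=> //.
  by rewrite /= (size0nil (s := enum _)) // size_enum_ord.
rewrite sum_collect big_allpairs_dep (reindex _ (onW_bij _ (insert_max_bij n))).
rewrite -(pair_bigA _ (fun i s => F (insert_max i s))) exchange_big /=.
rewrite (IHn _ (fun l => \sum_(q <- grow l) G q.1 *+ q.2)).
  apply: eq_bigr => p _; rewrite -sumrMnl; apply: eq_bigr => q _.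
  by rewrite nat_of_bin_mul mulrnA.
move=> s l /has_cycle_typeP[cs dec_cs <-{l}].
rewrite big_cons big_map -big_enum /= -(perm_big _ (perm_lift_enum n)) /= big_cons.
(* The first summand is [i = ord_max]; the remaining [i] are grouped by the cycle of [s] that they
   lie on. *)
congr (_ + _).
  apply: FG; apply: has_cycle_type_sort; apply: insert_max_fixed.
  by exists cs.
case: (dec_cs) => cs_enum _.
rewrite big_map -(perm_big _ cs_enum) big_flatten /= big_map.
apply: eq_big_seq => c cs_c.
rewrite big_seq.
(* All [size c] points of [c] lead to the same cycle type. *)
rewrite (eq_bigr (fun=> G (sort geq ((size c).+1 :: rem (size c) (shape cs))))).
  by rewrite -big_seq big_const_seq count_predT iter_addr_0 bin_of_natK.
move=> x c_x; apply: FG; apply: has_cycle_type_sort.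
exact: insert_max_lengthen dec_cs cs_c c_x.
Qed.

Local Close Scope ring_scope.

(** * Cycle counts and orbit sizes as return times *)

Section CycleCount.

Context {T : finType}.
Implicit Types (s : {perm T}) (x : T).

(** The cycles of length [k] partition the points lying on them into blocks of size [k]. *)
Lemma muln_ncycles k s : k * ncycles k s = #|[set x | #|porbit s x| == k]|.
Proof.
pose P := [set C in porbits s | #|C| == k].
have trivP : trivIset P.
  apply/trivIsetP=> _ _ /setIdP[/imsetP[x _ ->] _] /setIdP[/imsetP[y _ ->] _].
  apply: contraR => /pred0Pn[z /andP[/= zx zy]].
  by move: zx zy; rewrite -!eq_porbit_mem => /eqP<- /eqP<-.
rewrite (@card_uniform_partition _ k P) 1?mulnC //.
  by move=> C /setIdP[_ /eqP].
apply/and3P; split=> //; last first.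
  by apply/setIdP=> -[/imsetP[x _ /setP/(_ x)]]; rewrite porbit_id inE.
apply/eqP/setP=> x; rewrite inE.
apply/bigcupP/idP => [[_ /setIdP[/imsetP[y _ ->] yk]]|xk].
  by rewrite -eq_porbit_mem => /eqP->.
by exists (porbit s x); rewrite ?porbit_id // inE xk imset_f.
Qed.

(** The orbit size is the first return time to [x]. The trajectory starts at [s x], hence the
    successor. *)
Lemma card_porbit_index s x n : #|porbit s x| <= n ->
  #|porbit s x| = (index x (traject s (s x) n)).+1.
Proof.
have: 0 < #|porbit s x| by rewrite lt0n card_porbit_neq0.
have := uniq_traject_porbit s x; have := iter_porbit s x.
case: #|_| => // m; rewrite iterSr /= => sx /andP[x_notin _] _ lt_mn.
have lt_mt : m < size (traject s (s x) n) by rewrite size_traject.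
have nth_m : nth x (traject s (s x) n) m = x.
  by rewrite (set_nth_default (s x)) ?nth_traject.
rewrite -[traject _ _ n](cat_take_drop m) (drop_nth x) // nth_m.
by rewrite take_traject ?index_pivot ?size_traject // ltnW.
Qed.

End CycleCount.

(** * Computing induced cycle lengths from a cycle type *)

Fixpoint bitseqs (n : nat) : seq bitseq :=
  if n is n'.+1 then [seq b :: m | b <- [:: true; false], m <- bitseqs n']
  else [:: [::]].

Lemma mem_bitseqs n m : (m \in bitseqs n) = (size m == n).
Proof.
elim: n m => [|n IHn] [|b m] //=.
  by apply/negP; rewrite cats0 mem_cat => /orP[]/mapP[].
rewrite eqSS -IHn cats0 mem_cat.
have inj_cons c : injective (cons c : bitseq -> bitseq) by move=> ? ? [].
case: b; rewrite mem_map // ?orbF; apply/orP/idP => [[]|] //.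
- by case/mapP=> ? _ [].
- by left.
- by case/mapP=> ? _ [].
- by right.
Qed.

Lemma uniq_bitseqs n : uniq (bitseqs n).
Proof.
elim: n => //= n IHn; rewrite cats0 cat_uniq.
rewrite !map_inj_uniq ?IHn; try by move=> ? ? [].
by rewrite andbT; apply/hasPn => _ /mapP[m _ ->]; apply/mapP => -[].
Qed.

(* [m] is the characteristic sequence of a subset along the cycles of a
   permutation of cycle type [l]; see [bits_imset]. *)
Definition rotate_blocks (l : seq nat) (m : bitseq) : bitseq :=
  flatten (map (rotr 1) (reshape l m)).

(** [N] bounds the search; [subset_periods] uses the number of [r]-subsets, which no orbit
    exceeds. *)
Definition block_period (l : seq nat) (N : nat) (m : bitseq) : nat :=
  (index m (traject (rotate_blocks l) (rotate_blocks l m) N)).+1.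

Definition subset_periods (l : seq nat) (r : nat) : seq nat :=
  [seq block_period l 'C(sumn l, r) m | m <- bitseqs (sumn l) & count id m == r].

(** A cycle of length [k] contributes [k] entries equal to [k] to [ps], hence the division. *)
Definition subset_cycles (l : seq nat) (r : nat) : seq (nat * nat) :=
  let ps := subset_periods l r in
  [seq (k, count_mem k ps %/ k) | k <- iota 1 'C(sumn l, r) & k \in ps].

(** * Correctness of the computation, and faithfulness *)

Section InducedAction.

Variables n r : nat.
Implicit Types (s : 'S_n) (A : {set 'I_n}).

Lemma card_rsubset : #|rsubset n r| = 'C(n, r).
Proof.
rewrite card_sig -[in RHS](card_ord n) -card_draws.
by apply: eq_card => A; rewrite !inE.
Qed.

Section Bits.

Variable e : seq 'I_n.
Hypothesis e_enum : perm_eq e (enum 'I_n).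

Definition bits A : bitseq := [seq x \in A | x <- e].

Let e_all x : x \in e. Proof. by rewrite (perm_mem e_enum) mem_enum. Qed.

Lemma bits_inj : injective bits.
Proof. by move=> A B /eq_in_map eqAB; apply/setP=> x; exact: eqAB. Qed.

Lemma count_bits A : count id (bits A) = #|A|.
Proof.
by rewrite count_map (seq.permP e_enum) enumT cardE /enum_mem size_filter.
Qed.

Lemma perm_bits_rsubset :
  perm_eq [seq bits (val A) | A : rsubset n r]
    [seq m <- bitseqs n | count id m == r].
Proof.
have size_e : size e = n by rewrite (perm_size e_enum) size_enum_ord.
apply: uniq_perm.
- by rewrite map_inj_uniq ?enum_uniq // => A B /bits_inj/val_inj.
- exact/filter_uniq/uniq_bitseqs.
move=> m; rewrite mem_filter mem_bitseqs; apply/imageP/andP => [[A _ ->]|[m_r m_n]].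
  by rewrite count_bits (valP A) size_map size_e.
pose A := [set x | nth false m (index x e)].
have def_m : bits A = m.
  apply: (@eq_from_nth _ false); first by rewrite size_map size_e (eqP m_n).
  rewrite size_map => i lt_ie; have x0 : 'I_n by case: (e) lt_ie.
  rewrite (nth_map x0) // inE index_uniq //.
  by rewrite (perm_uniq e_enum) enum_uniq.
have A_r : #|A| == r by rewrite -count_bits def_m.
by exists (exist _ A A_r).
Qed.

End Bits.

(** Membership of [s x] in [s @: A] is membership of [x] in [A], so along each cycle the bits move
    one place to the right. *)
Lemma bits_imset s cs A : is_cycle_decomposition s cs ->
  bits (flatten cs) (s @: A) = rotate_blocks (shape cs) (bits (flatten cs) A).
Proof.
case=> _ cs_rot; rewrite /rotate_blocks /bits -map_reshape flattenK map_flatten.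
rewrite -map_comp; congr flatten; apply/eq_in_map => c cs_c /=.
apply: (canRL (rotK 1)); rewrite -map_rot -cs_rot // -map_comp.
by apply: eq_map => x /=; rewrite mem_imset //; exact: perm_inj.
Qed.

Lemma count_subset_periods k s l : has_cycle_type s l ->
  count_mem k (subset_periods l r) = k * ncycles k (induced r s).
Proof.
case/has_cycle_typeP=> cs dec_cs <-; have [cs_enum _] := dec_cs.
have cs_n : sumn (shape cs) = n.
  by rewrite -size_flatten (perm_size cs_enum) size_enum_ord.
rewrite muln_ncycles /subset_periods cs_n count_map.
rewrite -(seq.permP (perm_bits_rsubset cs_enum)) count_map.
rewrite enumT cardE /enum_mem size_filter; apply: eq_count => A /=.
rewrite inE (@card_porbit_index _ _ _ 'C(n, r)) -?card_rsubset ?max_card //.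
(* [f] is injective and intertwines [induced r s] with [rotate_blocks], so return times agree. *)
pose f (B : rsubset n r) := bits (flatten cs) (val B).
have f_inj : injective f by move=> B C /(bits_inj cs_enum)/val_inj.
have fM B : f (induced r s B) = rotate_blocks (shape cs) (f B).
  by rewrite /f permE bits_imset.
have f_traject N B :
    map f (traject (induced r s) B N) = traject (rotate_blocks (shape cs)) (f B) N.
  by elim: N B => //= N IHN B; rewrite IHN fM.
by rewrite -(index_map f_inj) f_traject fM.
Qed.

Lemma prod_subset_cycles s l : has_cycle_type s l ->
  (\prod_(1 <= k < #|rsubset n r|.+1) 'a_k ^+ ncycles k (induced r s) =
   \prod_(p <- subset_cycles l r) 'a_(p.1) ^+ p.2)%R.
Proof.
move=> s_l.
have l_n : sumn l = n.
  case/has_cycle_typeP: s_l => cs [cs_enum _] <-.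
  by rewrite -size_flatten (perm_size cs_enum) size_enum_ord.
rewrite big_map big_filter card_rsubset l_n /index_iota subn1 /= [RHS]big_mkcond.
apply: eq_big_seq => k; rewrite mem_iota => /andP[k_gt0 _].
rewrite (count_subset_periods _ s_l) mulKn //.
case: ifPn => // k_notin.
have /eqP := count_subset_periods k s_l; rewrite (count_memPn k_notin).
by rewrite eq_sym muln_eq0 -[k == 0]negbK -lt0n k_gt0 => /eqP->; rewrite expr0.
Qed.

(** If [s] moves [x], then adding [x] to r-1 points that avoid [x] and [s x] gives an [r]-subset
    that the induced permutation moves. *)
Lemma injm_induced : 0 < r < n -> ('injm (@induced_morphism n r))%g.
Proof.
case/andP=> r_gt0 lt_rn; apply/subsetP=> s /morphpreP[_ /set1P s1].
apply/set1P/permP=> x; rewrite perm1; apply/eqP/negPn/negP => sx.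
have [B] : exists B : {set 'I_n},
    B \in [set B : {set 'I_n} | B \subset ~: [set x; s x] & #|B| == r.-1].
  (* The complement of the pair has n-2 points, and r-1 <= n-2 since r < n. *)
  apply/card_gt0P; rewrite cards_draws bin_gt0 cardsCs setCK card_ord cards2.
  by rewrite eq_sym sx -subn1 -subSS leq_sub2r.
rewrite inE subsetC => /andP[/subsetP sB B_r].
have x_B : x \notin B by have /= := sB x; rewrite !inE eqxx => /(_ isT).
have sx_B : s x \notin B.
  by have /= := sB (s x); rewrite !inE eqxx orbT => /(_ isT).
have A_r : #|x |: B| == r by rewrite cardsU1 x_B (eqP B_r) add1n prednK.
pose A : rsubset n r := exist _ (x |: B) A_r.
have /(congr1 val)/= := congr1 (fun t : {perm rsubset n r} => t A) s1.
rewrite permE perm1 /= => /setP/(_ (s x)).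
by rewrite imset_f ?setU11 // !inE (negPf sx) (negPf sx_B).
Qed.

End InducedAction.

(** * The cycle index of the r-group and its value for n = 9, r = 3 *)

Local Open Scope ring_scope.

Lemma cycle_index_rgroup n r : (0 < r < n)%N ->
  cycle_index (rgroup n r) = (n`!%:R : rat)^-1 *:
    \sum_(p <- cycle_types n)
      (\prod_(q <- subset_cycles p.1 r) 'a_(q.1) ^+ q.2) *+ p.2.
Proof.
move=> r_n; have inj_ind := injm_induced r_n.
have rgroup_card : #|rgroup n r| = n`!.
  by rewrite (card_injm inj_ind (subxx _)) cardsT card_Sn.
rewrite /cycle_index rgroup_card; congr (_ *: _).
rewrite /= morphimEdom big_imset /=; last exact/injmP.
rewrite (eq_bigl xpredT) => [|s]; last by rewrite inE.
apply: (sum_cycle_types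
  (G := fun l => \prod_(q <- subset_cycles l r) 'a_(q.1) ^+ q.2)).
exact: prod_subset_cycles.
Qed.


Definition subset_cycles_9_3 : seq (seq (nat * nat) * N) :=
  [:: ([:: (1, 84)], 1%num);
      ([:: (1, 42); (2, 21)], 36%num);
      ([:: (1, 21); (3, 21)], 168%num);
      ([:: (1, 20); (2, 32)], 378%num);
      ([:: (1, 10); (2, 37)], 1260%num);
      ([:: (1, 10); (2, 5); (4, 16)], 756%num);
      ([:: (1, 9); (2, 6); (3, 11); (6, 5)], 2520%num);
      ([:: (1, 5); (2, 8); (3, 5); (6, 8)], 7560%num);
      ([:: (1, 4); (2, 40)], 945%num);
      ([:: (1, 4); (2, 8); (4, 16)], 7560%num);
      ([:: (1, 4); (5, 16)], 3024%num);
      ([:: (1, 3); (3, 27)], 5600%num);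
      ([:: (1, 3); (3, 13); (6, 7)], 10080%num);
      ([:: (1, 2); (2, 1); (5, 8); (10, 4)], 18144%num);
      ([:: (1, 2); (2, 9); (4, 16)], 11340%num);
      ([:: (1, 1); (2, 2); (3, 3); (4, 4); (6, 1); (12, 4)], 15120%num);
      ([:: (1, 1); (2, 2); (3, 1); (4, 4); (6, 2); (12, 4)], 15120%num);
      ([:: (1, 1); (3, 1); (5, 4); (15, 4)], 24192%num);
      ([:: (1, 1); (2, 10); (3, 3); (6, 9)], 2520%num);
      ([:: (1, 1); (2, 1); (3, 3); (6, 12)], 30240%num);
      ([:: (1, 1); (2, 1); (3, 1); (6, 13)], 30240%num);
      ([:: (2, 2); (5, 4); (10, 6)], 9072%num);
      ([:: (4, 1); (5, 2); (10, 1); (20, 3)], 18144%num);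
      ([:: (7, 6); (14, 3)], 25920%num);
      ([:: (2, 2); (4, 20)], 11340%num);
      ([:: (3, 1); (9, 9)], 40320%num);
      ([:: (4, 1); (8, 10)], 45360%num);
      ([:: (7, 12)], 25920%num)]%N.

(** The 30 cycle types give 28 terms: (3,3,3) and (3,3,1,1,1) induce the same cycle structure, and
    so do (6,3) and (6,1,1,1). *)
Lemma collect_subset_cycles_9_3 :
  perm_eq (collect [seq (subset_cycles p.1 3, p.2) | p <- cycle_types 9])
    subset_cycles_9_3.
Proof. by vm_compute. Qed.

(** Left folds unfold to the left-associated sums and products, coefficient first, in which the
    final formula is written. *)
Lemma sum_terms_foldl (R : pzSemiRingType) (a : nat -> R)
    (t : seq (seq (nat * nat) * N)) :
  \sum_(p <- t) (\prod_(q <- p.1) a q.1 ^+ q.2) *+ nat_of_bin p.2 =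
  foldl (fun y p => y + foldl (fun x q => x * a q.1 ^+ q.2) (nat_of_bin p.2)%:R p.1) 0 t.
Proof.
have prod_foldl l x : x * \prod_(q <- l) a q.1 ^+ q.2 =
    foldl (fun x q => x * a q.1 ^+ q.2) x l.
  elim: l x => [|q l IHl] x; first by rewrite big_nil mulr1.
  by rewrite big_cons mulrA IHl.
rewrite -[LHS]add0r; move: {1 3}0; elim: t => [|p t IHt] y; first by rewrite big_nil addr0.
by rewrite big_cons addrA IHt -mulr_natl prod_foldl.
Qed.

Theorem mainTheorem5 :
  cycle_index (rgroup 9 3) =
  (9`!%:R : rat)^-1 *:
    ('a_1 ^+ 84
     + 36%num%:R * 'a_1 ^+ 42 * 'a_2 ^+ 21
     + 168%num%:R * 'a_1 ^+ 21 * 'a_3 ^+ 21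
     + 378%num%:R * 'a_1 ^+ 20 * 'a_2 ^+ 32
     + 1260%num%:R * 'a_1 ^+ 10 * 'a_2 ^+ 37
     + 756%num%:R * 'a_1 ^+ 10 * 'a_2 ^+ 5 * 'a_4 ^+ 16
     + 2520%num%:R * 'a_1 ^+ 9 * 'a_2 ^+ 6 * 'a_3 ^+ 11 * 'a_6 ^+ 5
     + 7560%num%:R * 'a_1 ^+ 5 * 'a_2 ^+ 8 * 'a_3 ^+ 5 * 'a_6 ^+ 8
     + 945%num%:R * 'a_1 ^+ 4 * 'a_2 ^+ 40
     + 7560%num%:R * 'a_1 ^+ 4 * 'a_2 ^+ 8 * 'a_4 ^+ 16
     + 3024%num%:R * 'a_1 ^+ 4 * 'a_5 ^+ 16
     + 5600%num%:R * 'a_1 ^+ 3 * 'a_3 ^+ 27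
     + 10080%num%:R * 'a_1 ^+ 3 * 'a_3 ^+ 13 * 'a_6 ^+ 7
     + 18144%num%:R * 'a_1 ^+ 2 * 'a_2 * 'a_5 ^+ 8 * 'a_10 ^+ 4
     + 11340%num%:R * 'a_1 ^+ 2 * 'a_2 ^+ 9 * 'a_4 ^+ 16
     + 15120%num%:R * 'a_1 * 'a_2 ^+ 2 * 'a_3 ^+ 3 * 'a_4 ^+ 4 * 'a_6 * 'a_12 ^+ 4
     + 15120%num%:R * 'a_1 * 'a_2 ^+ 2 * 'a_3 * 'a_4 ^+ 4 * 'a_6 ^+ 2 * 'a_12 ^+ 4
     + 24192%num%:R * 'a_1 * 'a_3 * 'a_5 ^+ 4 * 'a_15 ^+ 4
     + 2520%num%:R * 'a_1 * 'a_2 ^+ 10 * 'a_3 ^+ 3 * 'a_6 ^+ 9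
     + 30240%num%:R * 'a_1 * 'a_2 * 'a_3 ^+ 3 * 'a_6 ^+ 12
     + 30240%num%:R * 'a_1 * 'a_2 * 'a_3 * 'a_6 ^+ 13
     + 9072%num%:R * 'a_2 ^+ 2 * 'a_5 ^+ 4 * 'a_10 ^+ 6
     + 18144%num%:R * 'a_4 * 'a_5 ^+ 2 * 'a_10 * 'a_20 ^+ 3
     + 25920%num%:R * 'a_7 ^+ 6 * 'a_14 ^+ 3
     + 11340%num%:R * 'a_2 ^+ 2 * 'a_4 ^+ 20
     + 40320%num%:R * 'a_3 * 'a_9 ^+ 9
     + 45360%num%:R * 'a_4 * 'a_8 ^+ 10
     + 25920%num%:R * 'a_7 ^+ 12).
Proof.
rewrite (@cycle_index_rgroup 9 3 isT); congr (_ *: _).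
rewrite -(big_map (fun p => (subset_cycles p.1 3, p.2)) xpredT
  (fun p => (\prod_(q <- p.1) 'a_(q.1) ^+ q.2) *+ nat_of_bin p.2)).
rewrite -(sum_collect (fun l => \prod_(q <- l) 'a_(q.1) ^+ q.2)).
rewrite (perm_big _ collect_subset_cycles_9_3).
rewrite sum_terms_foldl /subset_cycles_9_3; cbn [foldl fst snd].
(* This removes the initial 0 of the fold and the coefficient 1 of the leading term; the rest agrees
   by conversion. *)
by rewrite add0r [1%num%:R * _]mul1r.
Qed.
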